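(* There exists a groupoid $\mathfrak{G}$ with a dominant birational morphism $\pi:\mathfrak{G}\to\overline{\Phi}$ such that $\llbracket\pi(u),\pi(u\star v),\pi(v)\rrbracket=0$ whenever $u,v\in\mathfrak{G}$ and $u\star v$ is defined.
   Context: A groupoid is a set $\mathfrak{G}$ with a partially defined composition $\star$ and an inverse map $x\mapsto x'$ such that: if $a\star b$ and $b\star c$ are defined then $(a\star b)\star c$ and $a\star(b\star c)$ are defined and equal; $a\star a'$ and $a'\star a$ are always defined; and if $a\star b$ is defined then $a\star b\star b'=a$ and $a'\star a\star b=b$. Let $V=\mathbb{C}^2$. For $r,s,t\in\operatorname{End}(V\otimes V)$, $$\llbracket r,s,t\rrbracket=(r\otimes I_V)(I_V\otimes s)(t\otimes I_V)-(I_V\otimes t)(s\otimes I_V)(I_V\otimes r)\in\operatorname{End}(V\otimes V\otimes V).$$ A six-vertex matrix is an endomorphism $v$ of $V\otimes V$ whose matrix in the basis $e_1\otimes e_1,e_1\otimes e_2,e_2\otimes e_1,e_2\otimes e_2$ has the form $$v=\begin{pmatrix}a_1(v)&0&0&0\\0&c_1(v)&b_1(v)&0\\0&b_2(v)&c_2(v)&0\\0&0&0&a_2(v)\end{pmatrix},\qquad c_1(v),c_2(v)\neq0.$$ Put $N(v)=a_1(v)a_2(v)+b_1(v)b_2(v)-c_1(v)c_2(v)$. $\Phi$ is the set of six-vertex matrices $v$ with $b_2(v)=0$ and $a_1(v),a_2(v),b_1(v),c_1(v),c_2(v),N(v)$ all nonzero. $\Phi_b$ is the set of six-vertex matrices with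 $a_1(v),a_2(v),c_1(v),c_2(v)$ nonzero, $b_1(v)=b_2(v)=0$ and $N(v)=0$. $\overline{\Phi}=\Phi\cup\Phi_b$. Here $\mathfrak{G}$ carries the structure of an irreducible quasi-affine complex variety, and $\overline{\Phi}$ is regarded as a subset of the affine space with coordinates $a_1,a_2,b_1,c_1,c_2$. ''Dominant birational morphism $\pi:\mathfrak{G}\to\overline{\Phi}$'' means a morphism of varieties into this affine space, with image contained in $\overline{\Phi}$ and dense, that restricts to an isomorphism from a nonempty open subset of $\mathfrak{G}$ onto a nonempty open subset of $\Phi$. *)

(* Defs.v *)
From mathcomp Require Import all_boot all_order all_algebra.
From mathcomp Require Import mpoly.
From mathcomp Require Import classical_sets reals.
From mathcomp Require Import complex mxtens.

Set Implicit Arguments.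
Unset Strict Implicit.
Unset Printing Implicit Defensive.

Import GRing.Theory.
Local Open Scope ring_scope.
Local Open Scope classical_set_scope.

(* [gcomp a b = None] means that the composite of a and b is undefined. *)
Record groupoid (T : Type) := Groupoid {
  gcomp : T -> T -> option T;
  ginv : T -> T;
  gcompA : forall a b c ab bc,
    gcomp a b = Some ab -> gcomp b c = Some bc ->
    exists d, gcomp ab c = Some d /\ gcomp a bc = Some d;
  gcompV : forall a,
    (exists d, gcomp a (ginv a) = Some d) /\
    (exists d, gcomp (ginv a) a = Some d);
  gcompK : forall a b ab, gcomp a b = Some ab ->
    gcomp ab (ginv b) = Some a /\ gcomp (ginv a) ab = Some b
}.

(* Points of affine n-space are row vectors.  Maps between subsets of affine
   spaces are total functions of which only the values on the source matter. *)
Section Zariski.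
Variable F : fieldType.

Definition zariski_closed n (Z : set 'rV[F]_n) : Prop :=
  exists S : set {mpoly F[n]},
    Z = [set x | forall p, S p -> p.@[x 0] = 0].

Definition zariski_open n (U : set 'rV[F]_n) : Prop := zariski_closed (~` U).

Definition zariski_open_in n (X U : set 'rV[F]_n) : Prop :=
  exists2 O, zariski_open O & U = X `&` O.

Definition zariski_dense_in n (X A : set 'rV[F]_n) : Prop :=
  A `<=` X /\ forall Z, zariski_closed Z -> A `<=` Z -> X `<=` Z.

Definition quasi_affine n (X : set 'rV[F]_n) : Prop :=
  exists2 Z, zariski_closed Z & zariski_open_in Z X.

Definition irreducible n (X : set 'rV[F]_n) : Prop :=
  X !=set0 /\
  forall Z1 Z2, zariski_closed Z1 -> zariski_closed Z2 ->
    X `<=` Z1 `|` Z2 -> X `<=` Z1 \/ X `<=` Z2.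

Definition regular_fun n (X : set 'rV[F]_n) (f : 'rV[F]_n -> F) : Prop :=
  forall x, X x -> exists (U : set 'rV[F]_n) (p q : {mpoly F[n]}),
    [/\ zariski_open U, U x &
        forall y, X y -> U y -> q.@[y 0] != 0 /\ f y = p.@[y 0] / q.@[y 0]].

Definition regular_map n m (X : set 'rV[F]_n) (f : 'rV[F]_n -> 'rV[F]_m) :
    Prop :=
  forall i, regular_fun X (fun x => f x 0 i).

Definition isomorphism n m (X : set 'rV[F]_n) (Y : set 'rV[F]_m)
    (f : 'rV[F]_n -> 'rV[F]_m) : Prop :=
  [/\ regular_map X f, f @` X `<=` Y &
    exists g : 'rV[F]_m -> 'rV[F]_n,
      [/\ regular_map Y g, g @` Y `<=` X,
          forall x, X x -> g (f x) = x & forall y, Y y -> f (g y) = y]].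

End Zariski.

Section SixVertex.
Variable F : fieldType.

(* End(V (x) V) is 'M_(2 * 2): the basis vector e_i (x) e_j has index
   [mxtens_index (i, j)], and [A *t B] is the Kronecker product. *)
Implicit Types r s t v : 'M[F]_(2 * 2).

Definition yb_left r : 'M[F]_(2 * 2 * 2) := r *t (1%:M : 'M[F]_2).

Definition yb_right r : 'M[F]_(2 * 2 * 2) :=
  castmx (mulnA 2 2 2, mulnA 2 2 2) ((1%:M : 'M[F]_2) *t r).

Definition yb_bracket r s t : 'M[F]_(2 * 2 * 2) :=
  yb_left r *m yb_right s *m yb_left t
  - yb_right t *m yb_left s *m yb_right r.

Definition e11 : 'I_(2 * 2) := mxtens_index (0 : 'I_2, 0 : 'I_2).
Definition e12 : 'I_(2 * 2) := mxtens_index (0 : 'I_2, 1 : 'I_2).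
Definition e21 : 'I_(2 * 2) := mxtens_index (1 : 'I_2, 0 : 'I_2).
Definition e22 : 'I_(2 * 2) := mxtens_index (1 : 'I_2, 1 : 'I_2).

Definition a1 v := v e11 e11.
Definition a2 v := v e22 e22.
Definition b1 v := v e12 e21.
Definition b2 v := v e21 e12.
Definition c1 v := v e12 e12.
Definition c2 v := v e21 e21.

Definition six_vertex v : Prop :=
  [/\ v = \matrix_(i, j) nth 0 (nth [::]
        [:: [:: a1 v; 0;    0;    0];
            [:: 0;    c1 v; b1 v; 0];
            [:: 0;    b2 v; c2 v; 0];
            [:: 0;    0;    0;    a2 v]] i) j,
      c1 v != 0 & c2 v != 0].

Definition sv_N v : F := a1 v * a2 v + b1 v * b2 v - c1 v * c2 v.

Definition Phi : set 'M[F]_(2 * 2) :=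
  [set v | six_vertex v /\ b2 v = 0 /\
    [/\ a1 v != 0, a2 v != 0, b1 v != 0 & [/\ c1 v != 0, c2 v != 0 & sv_N v != 0]]].

Definition Phi_b : set 'M[F]_(2 * 2) :=
  [set v | six_vertex v /\
    [/\ a1 v != 0, a2 v != 0, c1 v != 0 & c2 v != 0] /\
    [/\ b1 v = 0, b2 v = 0 & sv_N v = 0]].

Definition Phi_bar : set 'M[F]_(2 * 2) := Phi `|` Phi_b.

(* This is injective on [Phi_bar], where b2 = 0. *)
Definition sv_coord v : 'rV[F]_5 :=
  \row_i nth 0 [:: a1 v; a2 v; b1 v; c1 v; c2 v] i.

Definition dominant_birational_morphism n (G : set 'rV[F]_n)
    (pi : 'rV[F]_n -> 'M[F]_(2 * 2)) : Prop :=
  [/\ pi @` G `<=` Phi_bar,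
      regular_map G (sv_coord \o pi),
      zariski_dense_in (sv_coord @` Phi_bar) ((sv_coord \o pi) @` G) &
      exists (U : set 'rV[F]_n) (W : set 'rV[F]_5),
        [/\ zariski_open_in G U, U !=set0,
            zariski_open_in (sv_coord @` Phi) W, W !=set0 &
            isomorphism U W (sv_coord \o pi)]].

End SixVertex.

(* Main.v *)
Require Import Defs.
From mathcomp Require Import all_boot all_order all_algebra.
From mathcomp Require Import mpoly.
From mathcomp Require Import classical_sets reals.
From mathcomp Require Import complex mxtens.
From mathcomp Require Import boolp ring.

(**
The groupoid is the action groupoid of the torus of quadruples
(a1, a2, c1, c2) on the punctured line, on which a1 / a2 acts by scaling.
On Phi, the two ends of the arrow v are N(v) / (a1(v) b1(v)) and
N(v) / (a2(v) b1(v)): if the first end of u is the second end of v, then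
the bracket of u, w, v vanishes for the w in which a1, a2, c1, c2 multiply
and whose ends are the first end of v and the second end of u.  On Phi_b both
N and b1 vanish and the ends are lost, so a coordinate has to be added.  We
use m = b1 / N, which makes pi polynomial through b1 = m N.
*)

Set Implicit Arguments.
Unset Strict Implicit.
Unset Printing Implicit Defensive.

Import GRing.Theory.
Local Open Scope ring_scope.
Local Open Scope classical_set_scope.

(** * Basic open sets and regular functions in the Zariski topology *)

Section ZariskiFacts.
Variable F : fieldType.

Lemma zariski_closedT n : zariski_closed (@setT 'rV[F]_n).
Proof. by exists classical_sets.set0; apply/seteqP; split=> // x _ p []. Qed.

Lemma zariski_openT n : zariski_open (@setT 'rV[F]_n).
Proof.
exists [set 1]; apply/seteqP; split => x /=; first by case.
by move=> /(_ 1 erefl) /eqP; rewrite meval1 oner_eq0.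
Qed.

Lemma zariski_open_neq0 n (q : {mpoly F[n]}) :
  zariski_open [set x | q.@[x 0] != 0].
Proof.
exists [set q]; apply/seteqP; split => x /=.
  by move=> /negP; rewrite negbK => /eqP qx0 p ->.
by move=> /(_ q erefl) ->; rewrite eqxx.
Qed.

Lemma regular_fun_frac n (X : set 'rV[F]_n) (p q : {mpoly F[n]}) f :
  (forall y, X y -> q.@[y 0] != 0 /\ f y = p.@[y 0] / q.@[y 0]) ->
  regular_fun X f.
Proof.
move=> fE x Xx; exists setT, p, q; split=> //; first exact: zariski_openT.
by move=> y Xy _; exact: fE.
Qed.

Lemma regular_fun_poly n (X : set 'rV[F]_n) (p : {mpoly F[n]}) f :
  (forall y, X y -> f y = p.@[y 0]) -> regular_fun X f.
Proof.
move=> fE; apply: (@regular_fun_frac _ _ p 1) => y Xy.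
by rewrite meval1 oner_eq0 divr1 fE.
Qed.

End ZariskiFacts.

(** * Irreducibility of principal open subsets of affine space *)

Section Irreducibility.
Variable F : closedFieldType.

(** Substituting univariate polynomials for the variables restricts [p] to a parametrized curve;
    below, the curve is a line. *)
Lemma horner_mmap n (h : 'I_n -> {poly F}) (p : {mpoly F[n]}) t :
  (mmap polyC h p).[t] = p.@[fun i => (h i).[t]].
Proof.
rewrite /meval /mmap horner_sum; apply: eq_bigr => m _.
rewrite hornerM hornerC /mmap1 horner_prod; congr (_ * _).
by apply: eq_bigr => i _; rewrite horner_exp.
Qed.

(* Restricting to the line through two points reduces the claim to the fact
   that a nonzero univariate polynomial has a non-root. *)
Lemma irreducible_neq0 n (q : {mpoly F[n]}) :
  [set x : 'rV[F]_n | q.@[x 0] != 0] !=set0 ->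
  irreducible [set x : 'rV[F]_n | q.@[x 0] != 0].
Proof.
move=> q_neq0; split=> // _ _ [S1 ->] [S2 ->] qS12.
apply: contrapT => /not_orP[].
move=> /existsNP[x /not_implyP[qx /existsNP[p1 /not_implyP[S1p1 p1x]]]].
move=> /existsNP[y /not_implyP[qy /existsNP[p2 /not_implyP[S2p2 p2y]]]].
pose line (i : 'I_n) := (x 0 i)%:P + (y 0 i - x 0 i) *: 'X.
have line_eval p t :
    (mmap polyC line p).[t] = p.@[(\row_i (line i).[t]) 0].
  by rewrite horner_mmap; apply: meval_eq => i; rewrite mxE.
have line0 : \row_i (line i).[0] = x.
  by apply/rowP => i; rewrite mxE !hornerE.
have line1 : \row_i (line i).[1] = y.
  apply/rowP => i; rewrite mxE hornerD hornerC hornerZ hornerX mulr1.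
  by rewrite addrC subrK.
have line_neq0 p t : p.@[(\row_i (line i).[t]) 0] != 0 ->
    mmap polyC line p != 0.
  by apply: contraNneq => p0; rewrite -line_eval p0 horner0.
(* At t = 0 neither [q] nor [p1] vanishes, and at t = 1 [p2] does not, so none of the three
   restrictions is the zero polynomial. *)
have nz : mmap polyC line q * mmap polyC line p1 * mmap polyC line p2 != 0.
  rewrite !mulf_neq0 //; first by apply: (line_neq0 _ 0); rewrite line0.
    by apply: (line_neq0 _ 0); rewrite line0; exact/eqP.
  by apply: (line_neq0 _ 1); rewrite line1; exact/eqP.
(* A common non-root gives a point of the line where [q] is nonzero and which lies in neither closed
   set. *)
have /closed_nonrootP[t] := nz.
rewrite /root !hornerM !mulf_eq0 !negb_or !line_eval -andbA.
move=> /and3P[qt p1t p2t].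
by case: (qS12 _ qt) => /= [/(_ p1 S1p1)|/(_ p2 S2p2)] /eqP; apply/negP.
Qed.

End Irreducibility.

(** * The groupoid on the five-dimensional torus *)

Section Model.
Variable F : fieldType.

Definition row5 (x0 x1 x2 x3 x4 : F) : 'rV[F]_5 :=
  \row_i nth 0 [:: x0; x1; x2; x3; x4] i.

Lemma row5E x0 x1 x2 x3 x4 (x := row5 x0 x1 x2 x3 x4) :
  (x 0 0 = x0) * (x 0 1 = x1) * (x 0 2 = x2) * (x 0 3 = x3) * (x 0 4 = x4).
Proof. by rewrite /x !mxE. Qed.

Lemma forall_ord5 (P : 'I_5 -> Prop) :
  P 0 -> P 1 -> P 2 -> P 3 -> P 4 -> forall i, P i.
Proof.
move=> P0 P1 P2 P3 P4 i.
have E (j : 'I_5) : val i = val j -> P j -> P i by move=> /val_inj ->.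
by case: i E => -[|[|[|[|[|i]]]]] // Hi E;
  [apply: E P0|apply: E P1|apply: E P2|apply: E P3|apply: E P4].
Qed.

Lemma row5P (x y : 'rV[F]_5) :
  x 0 0 = y 0 0 -> x 0 1 = y 0 1 -> x 0 2 = y 0 2 -> x 0 3 = y 0 3 ->
  x 0 4 = y 0 4 -> x = y.
Proof. by move=> *; apply/rowP; apply: forall_ord5. Qed.

Definition torus n : set 'rV[F]_n := [set x | forall i, x 0 i != 0].

(** A single nonvanishing condition makes the torus a principal open set, which gives both its
    openness and its irreducibility. *)
Lemma torusE n :
  @torus n = [set x | (\prod_(i < n) 'X_i : {mpoly F[n]}).@[x 0] != 0].
Proof.
apply/seteqP; split => x /=; rewrite rmorph_prod /=.
  by move=> xP; apply/prodf_neq0 => i _; rewrite mevalXU.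
by move=> /prodf_neq0 xP i; rewrite -(mevalXU (x 0)) xP.
Qed.

(* The coordinates of a point of the torus are (a1, a2, m, c1, c2); the ends of
   the arrow are 1 / (a1 m) and 1 / (a2 m). *)
Definition composable (x y : 'rV[F]_5) := x 0 0 * x 0 2 == y 0 1 * y 0 2.

(** The value of m is forced by the first end being that of [y]. By composability it also equals
    m(x) / a2(y), so the second end is that of [x]. *)
Definition comp5 (x y : 'rV[F]_5) := row5 (x 0 0 * y 0 0) (x 0 1 * y 0 1)
  (y 0 2 / x 0 0) (x 0 3 * y 0 3) (x 0 4 * y 0 4).

(** With m replaced by a1 a2 m, inverting a1 and a2 exchanges the two ends. *)
Definition inv5 (x : 'rV[F]_5) := row5 (x 0 0)^-1 (x 0 1)^-1
  (x 0 0 * x 0 1 * x 0 2) (x 0 3)^-1 (x 0 4)^-1.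

Lemma torus_comp5 x y : torus x -> torus y -> torus (comp5 x y).
Proof.
move=> tx ty; apply: forall_ord5;
  by rewrite row5E ?mulf_neq0 ?invr_neq0.
Qed.

Lemma torus_inv5 x : torus x -> torus (inv5 x).
Proof.
move=> tx; apply: forall_ord5;
  by rewrite row5E ?mulf_neq0 ?invr_neq0.
Qed.

Definition tcomp (u v : @torus 5) : option (@torus 5) :=
  if composable (val u) (val v) then insub (comp5 (val u) (val v)) else None.

(** The default value [u] is never taken, since [inv5] preserves the torus. *)
Definition tinv (u : @torus 5) : @torus 5 := insubd u (inv5 (val u)).

Lemma torus_val n (u : @torus n) : torus (val u).
Proof. exact: set_mem (valP u). Qed.

Lemma val_tinv u : val (tinv u) = inv5 (val u).
Proof. by rewrite insubdK //; apply/mem_set/torus_inv5/torus_val. Qed.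

Lemma tcompP u v w :
  tcomp u v = Some w <->
  composable (val u) (val v) /\ val w = comp5 (val u) (val v).
Proof.
rewrite /tcomp; case: ifP => _; last by split=> [|[]].
have tuv : comp5 (val u) (val v) \in @torus 5.
  by apply/mem_set/torus_comp5; exact: torus_val.
rewrite insubT /=; split=> [[<-]|[_ wE]]; first by [].
by congr Some; apply: val_inj.
Qed.

Lemma tcomp_some u v :
  composable (val u) (val v) -> exists w, tcomp u v = Some w.
Proof.
move=> uv; rewrite /tcomp uv.
have tuv : comp5 (val u) (val v) \in @torus 5.
  by apply/mem_set/torus_comp5; exact: torus_val.
by rewrite insubT; eexists.
Qed.

Lemma tcompA a b c ab bc :
  tcomp a b = Some ab -> tcomp b c = Some bc ->
  exists d, tcomp ab c = Some d /\ tcomp a bc = Some d.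
Proof.
move=> /tcompP[cab abE] /tcompP[cbc bcE].
have ta := torus_val a; have tb := torus_val b; have tc := torus_val c.
have [d dE] : exists d, tcomp ab c = Some d.
  apply: tcomp_some; move: cbc; rewrite abE /composable !row5E => /eqP <-.
  by apply/eqP; field.
exists d; split=> //; apply/tcompP; split.
  (* The second end of [bc] is that of [b], because [b] and [c] are composable. *)
  move: cab cbc; rewrite bcE /composable !row5E => /eqP -> /eqP E.
  by apply/eqP; rewrite -mulrA [_ * (_ / _)]mulrA -E; field.
move: dE => /tcompP[_ ->]; rewrite abE bcE.
by apply: row5P; rewrite !row5E ?mulrA ?invfM //; field; rewrite ta tb.
Qed.

Lemma tcompV a :
  (exists d, tcomp a (tinv a) = Some d) /\
  (exists d, tcomp (tinv a) a = Some d).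
Proof.
have ta := torus_val a.
by split; apply: tcomp_some; rewrite val_tinv /composable !row5E;
  apply/eqP; field.
Qed.

Lemma tcompK a b ab : tcomp a b = Some ab ->
  tcomp ab (tinv b) = Some a /\ tcomp (tinv a) ab = Some b.
Proof.
move=> /tcompP[cab abE].
have ta := torus_val a; have tb := torus_val b.
split; apply/tcompP; rewrite val_tinv abE /composable !row5E; split.
- by apply/eqP; field; rewrite ?ta ?tb.
- apply: row5P; rewrite !row5E; try by field; rewrite ?ta ?tb.
  (* Only m remains, the one coordinate that depends on composability; multiplying by a1(a) makes
     that equation applicable. *)
  by apply: (mulfI (ta 0)); rewrite (eqP cab); field; rewrite ?ta ?tb.
- move: cab => /eqP E; apply/eqP; rewrite !mulrA -[_ * _ * val b 0 2]mulrA -E.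
  by field.
- by apply: row5P; rewrite !row5E; field; rewrite ?oner_eq0 ?ta ?tb.
Qed.

Definition torus_groupoid : groupoid (@torus 5) :=
  Groupoid tcompA tcompV tcompK.

End Model.

(** * The Yang-Baxter identity by explicit 8 by 8 matrices *)

Section YangBaxter.
Variable F : fieldType.

(** Every element of [Phi_bar] has b2 = 0 and so has this shape; the arguments are a1, a2, b1, c1,
    c2. *)
Definition five_vertex (x1 x2 y z1 z2 : F) : 'M[F]_(2 * 2) :=
  \matrix_(i, j) nth 0 (nth [::]
    [:: [:: x1; 0;  0;  0];
        [:: 0;  z1; y;  0];
        [:: 0;  0;  z2; 0];
        [:: 0;  0;  0;  x2]] i) j.

Definition rows8 (s : seq (seq F)) : 'M[F]_(2 * 2 * 2) :=
  \matrix_(i, j) nth 0 (nth [::] s i) j.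

Lemma yb_left_five_vertex x1 x2 y z1 z2 :
  yb_left (five_vertex x1 x2 y z1 z2) = rows8
    [:: [:: x1; 0;  0;  0;  0;  0;  0;  0];
        [:: 0;  x1; 0;  0;  0;  0;  0;  0];
        [:: 0;  0;  z1; 0;  y;  0;  0;  0];
        [:: 0;  0;  0;  z1; 0;  y;  0;  0];
        [:: 0;  0;  0;  0;  z2; 0;  0;  0];
        [:: 0;  0;  0;  0;  0;  z2; 0;  0];
        [:: 0;  0;  0;  0;  0;  0;  x2; 0];
        [:: 0;  0;  0;  0;  0;  0;  0;  x2]].
Proof.
apply/matrixP => i j; rewrite !mxE.
by case: i => -[|[|[|[|[|[|[|[|i]]]]]]]] // Hi;
  case: j => -[|[|[|[|[|[|[|[|j]]]]]]]] // Hj;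
  rewrite /= ?mulr1 ?mulr0 ?mul0r.
Qed.

Lemma yb_right_five_vertex x1 x2 y z1 z2 :
  yb_right (five_vertex x1 x2 y z1 z2) = rows8
    [:: [:: x1; 0;  0;  0;  0;  0;  0;  0];
        [:: 0;  z1; y;  0;  0;  0;  0;  0];
        [:: 0;  0;  z2; 0;  0;  0;  0;  0];
        [:: 0;  0;  0;  x2; 0;  0;  0;  0];
        [:: 0;  0;  0;  0;  x1; 0;  0;  0];
        [:: 0;  0;  0;  0;  0;  z1; y;  0];
        [:: 0;  0;  0;  0;  0;  0;  z2; 0];
        [:: 0;  0;  0;  0;  0;  0;  0;  x2]].
Proof.
apply/matrixP => i j; rewrite /yb_right castmxE !mxE.
by case: i => -[|[|[|[|[|[|[|[|i]]]]]]]] // Hi;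
  case: j => -[|[|[|[|[|[|[|[|j]]]]]]]] // Hj;
  rewrite /= ?mul1r ?mulr0 ?mul0r.
Qed.

(** This product and the one in the opposite order begin the two terms of the bracket; computing
    them first leaves one multiplication in each term. *)
Lemma yb_left_mul_right x1 x2 y z1 z2 x1' x2' y' z1' z2' :
  yb_left (five_vertex x1 x2 y z1 z2) *m
  yb_right (five_vertex x1' x2' y' z1' z2') =
  rows8
    [:: [:: x1 * x1'; 0;        0;        0;        0;        0;        0;        0];
        [:: 0;        x1 * z1'; x1 * y';  0;        0;        0;        0;        0];
        [:: 0;        0;        z1 * z2'; 0;        y * x1';  0;        0;        0];
        [:: 0;        0;        0;        z1 * x2'; 0;        y * z1';  y * y';   0];
        [:: 0;        0;        0;        0;        z2 * x1'; 0;        0;        0];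
        [:: 0;        0;        0;        0;        0;        z2 * z1'; z2 * y';  0];
        [:: 0;        0;        0;        0;        0;        0;        x2 * z2'; 0];
        [:: 0;        0;        0;        0;        0;        0;        0;        x2 * x2']].
Proof.
rewrite yb_left_five_vertex yb_right_five_vertex.
apply/matrixP => i j; rewrite !mxE !big_ord_recl big_ord0 !mxE.
by case: i => -[|[|[|[|[|[|[|[|i]]]]]]]] // Hi;
  case: j => -[|[|[|[|[|[|[|[|j]]]]]]]] // Hj;
  rewrite /= ?(mul0r, mulr0, add0r, addr0).
Qed.

Lemma yb_right_mul_left x1 x2 y z1 z2 x1' x2' y' z1' z2' :
  yb_right (five_vertex x1 x2 y z1 z2) *m
  yb_left (five_vertex x1' x2' y' z1' z2') =
  rows8
    [:: [:: x1 * x1'; 0;        0;        0;        0;        0;        0;        0];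
        [:: 0;        z1 * x1'; y * z1';  0;        y * y';   0;        0;        0];
        [:: 0;        0;        z2 * z1'; 0;        z2 * y';  0;        0;        0];
        [:: 0;        0;        0;        x2 * z1'; 0;        x2 * y';  0;        0];
        [:: 0;        0;        0;        0;        x1 * z2'; 0;        0;        0];
        [:: 0;        0;        0;        0;        0;        z1 * z2'; y * x2';  0];
        [:: 0;        0;        0;        0;        0;        0;        z2 * x2'; 0];
        [:: 0;        0;        0;        0;        0;        0;        0;        x2 * x2']].
Proof.
rewrite yb_left_five_vertex yb_right_five_vertex.
apply/matrixP => i j; rewrite !mxE !big_ord_recl big_ord0 !mxE.
by case: i => -[|[|[|[|[|[|[|[|i]]]]]]]] // Hi;
  case: j => -[|[|[|[|[|[|[|[|j]]]]]]]] // Hj;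
  rewrite /= ?(mul0r, mulr0, add0r, addr0).
Qed.

(* k is the coordinate m of the middle factor, in terms of which composability
   lets the coordinates m of the outer ones be written without division. *)
Lemma yb_bracket_five_vertex (x1 x2 z1 z2 x1' x2' z1' z2' k : F) :
  yb_bracket
    (five_vertex x1 x2 (x2' * k * (x1 * x2 - z1 * z2)) z1 z2)
    (five_vertex (x1 * x1') (x2 * x2')
       (k * (x1 * x1' * (x2 * x2') - z1 * z1' * (z2 * z2')))
       (z1 * z1') (z2 * z2'))
    (five_vertex x1' x2' (x1 * k * (x1' * x2' - z1' * z2')) z1' z2') = 0.
Proof.
rewrite /yb_bracket yb_left_mul_right yb_right_mul_left.
rewrite yb_left_five_vertex yb_right_five_vertex.
apply/matrixP => i j; rewrite !mxE !big_ord_recl !big_ord0 !mxE.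
by case: i => -[|[|[|[|[|[|[|[|i]]]]]]]] // Hi;
  case: j => -[|[|[|[|[|[|[|[|j]]]]]]]] // Hj;
  (* Write N and N' for the values at the outer factors. Up to reordering factors, the entries
     reduce to two formulas for N of the middle one: x1' x2' N + z1 z2 N' and x1 x2 N' + z1' z2'
     N. *)
  rewrite /= ?(mul0r, mulr0, add0r, addr0, subr0) //; ring.
Qed.

End YangBaxter.

(** * The projection to [Phi_bar] and its inverse over [Phi] *)

Section Projection.
Variable F : numClosedFieldType.
Implicit Types x y : 'rV[F]_5.

Lemma five_vertexE (x1 x2 y z1 z2 : F) (v := five_vertex x1 x2 y z1 z2) :
  (a1 v = x1) * (a2 v = x2) * (b1 v = y) * (b2 v = 0) * (c1 v = z1)
  * (c2 v = z2).
Proof. by rewrite /v /a1 /a2 /b1 /b2 /c1 /c2 !mxE. Qed.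

Lemma sv_coord_five_vertex (x1 x2 y z1 z2 : F) :
  sv_coord (five_vertex x1 x2 y z1 z2) = row5 x1 x2 y z1 z2.
Proof. by rewrite /sv_coord !five_vertexE. Qed.

Lemma six_vertex_five_vertex (x1 x2 y z1 z2 : F) :
  z1 != 0 -> z2 != 0 -> six_vertex (five_vertex x1 x2 y z1 z2).
Proof.
by move=> z1_neq0 z2_neq0; split; rewrite !five_vertexE.
Qed.

Lemma six_vertex_b2_eq0 (v : 'M[F]_(2 * 2)) : six_vertex v -> b2 v = 0 ->
  v = five_vertex (a1 v) (a2 v) (b1 v) (c1 v) (c2 v).
Proof. by case=> vE _ _ b2v; rewrite {1}vE b2v. Qed.

Lemma sv_N_five_vertex (x1 x2 y z1 z2 : F) :
  sv_N (five_vertex x1 x2 y z1 z2) = x1 * x2 - z1 * z2.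
Proof.
by rewrite /sv_N !five_vertexE mulr0 addr0.
Qed.

Lemma Phi_five_vertex (x1 x2 y z1 z2 : F) :
  x1 != 0 -> x2 != 0 -> y != 0 -> z1 != 0 -> z2 != 0 ->
  x1 * x2 - z1 * z2 != 0 -> Phi (five_vertex x1 x2 y z1 z2).
Proof.
move=> x1_neq0 x2_neq0 y_neq0 z1_neq0 z2_neq0 N_neq0.
split; first exact: six_vertex_five_vertex.
by rewrite sv_N_five_vertex !five_vertexE.
Qed.

Lemma Phi_b_five_vertex (x1 x2 z1 z2 : F) :
  x1 != 0 -> x2 != 0 -> z1 != 0 -> z2 != 0 ->
  x1 * x2 - z1 * z2 = 0 -> Phi_b (five_vertex x1 x2 0 z1 z2).
Proof.
move=> x1_neq0 x2_neq0 z1_neq0 z2_neq0 N0.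
split; first exact: six_vertex_five_vertex.
by rewrite sv_N_five_vertex !five_vertexE.
Qed.

Definition row5_N x := x 0 0 * x 0 1 - x 0 3 * x 0 4.

Definition proj x : 'M[F]_(2 * 2) :=
  five_vertex (x 0 0) (x 0 1) (x 0 2 * row5_N x) (x 0 3) (x 0 4).

Lemma sv_coord_proj x :
  sv_coord (proj x) = row5 (x 0 0) (x 0 1) (x 0 2 * row5_N x) (x 0 3) (x 0 4).
Proof. exact: sv_coord_five_vertex. Qed.

(** As m is nonzero, b1 = m N vanishes exactly when N does: the locus N = 0 goes to [Phi_b], its
    complement to [Phi]. *)
Lemma proj_Phi_bar x : torus x -> Phi_bar (proj x).
Proof.
move=> tx; rewrite /proj; have [N0|N_neq0] := eqVneq (row5_N x) 0.
  by right; rewrite N0 mulr0; apply: Phi_b_five_vertex.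
by left; apply: Phi_five_vertex => //; rewrite mulf_neq0.
Qed.

Definition mpoly_N : {mpoly F[5]} := 'X_0 * 'X_1 - 'X_3 * 'X_4.

Lemma meval_N x : mpoly_N.@[x 0] = row5_N x.
Proof. by rewrite mevalB !mevalM !mevalXU. Qed.

(** The third coordinate is read as m or as b1: the same set is the open part of the groupoid where
    N is nonzero and the coordinate image of [Phi]. *)
Definition torus_N : set 'rV[F]_5 := [set x | torus x /\ row5_N x != 0].

Lemma image_Phi : @sv_coord F @` @Phi F = torus_N.
Proof.
apply/seteqP; split=> [_ [v [sv [b2v [? ? ? [? ? Nv]]]] <-]|y [ty Ny]].
  move: Nv; rewrite (six_vertex_b2_eq0 sv b2v) sv_N_five_vertex.
  rewrite sv_coord_five_vertex => Nv; split.
    by apply: forall_ord5; rewrite row5E.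
  by rewrite /row5_N !row5E.
exists (five_vertex (y 0 0) (y 0 1) (y 0 2) (y 0 3) (y 0 4)).
  exact: Phi_five_vertex.
by rewrite sv_coord_five_vertex; apply: row5P; rewrite row5E.
Qed.

Definition lift_Phi y :=
  row5 (y 0 0) (y 0 1) (y 0 2 / row5_N y) (y 0 3) (y 0 4).

(** N does not involve the third coordinate, the only one that [proj] and [lift_Phi] change. *)
Lemma row5_N_row5 y t :
  row5_N (row5 (y 0 0) (y 0 1) t (y 0 3) (y 0 4)) = row5_N y.
Proof. by rewrite /row5_N !row5E. Qed.

Lemma torus_N_proj x : torus_N x -> torus_N (sv_coord (proj x)).
Proof.
move=> [tx Nx]; rewrite sv_coord_proj; split; last by rewrite row5_N_row5.
by apply: forall_ord5; rewrite row5E // mulf_neq0.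
Qed.

Lemma torus_N_lift y : torus_N y -> torus_N (lift_Phi y).
Proof.
move=> [ty Ny]; split; last by rewrite row5_N_row5.
by apply: forall_ord5; rewrite row5E // mulf_neq0 // invr_neq0.
Qed.

Lemma lift_PhiK x : torus_N x -> lift_Phi (sv_coord (proj x)) = x.
Proof.
move=> [tx Nx]; rewrite sv_coord_proj /lift_Phi.
by apply: row5P; rewrite row5_N_row5 !row5E // mulfK.
Qed.

Lemma proj_liftK y : torus_N y -> sv_coord (proj (lift_Phi y)) = y.
Proof.
move=> [ty Ny]; rewrite sv_coord_proj.
by apply: row5P; rewrite row5_N_row5 !row5E // divfK.
Qed.

Lemma regular_proj X : regular_map X (@sv_coord F \o proj).
Proof.
apply: forall_ord5.
- by apply: (regular_fun_poly (p := 'X_0)) => y _;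
    rewrite /= sv_coord_proj row5E mevalXU.
- by apply: (regular_fun_poly (p := 'X_1)) => y _;
    rewrite /= sv_coord_proj row5E mevalXU.
- by apply: (regular_fun_poly (p := 'X_2 * mpoly_N)) => y _;
    rewrite /= sv_coord_proj row5E mevalM mevalXU meval_N.
- by apply: (regular_fun_poly (p := 'X_3)) => y _;
    rewrite /= sv_coord_proj row5E mevalXU.
- by apply: (regular_fun_poly (p := 'X_4)) => y _;
    rewrite /= sv_coord_proj row5E mevalXU.
Qed.

Lemma regular_lift : regular_map torus_N lift_Phi.
Proof.
apply: forall_ord5.
- by apply: (regular_fun_poly (p := 'X_0)) => y _; rewrite row5E mevalXU.
- by apply: (regular_fun_poly (p := 'X_1)) => y _; rewrite row5E mevalXU.
- apply: (regular_fun_frac (p := 'X_2) (q := mpoly_N)) => y [_ Ny].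
  by rewrite row5E mevalXU meval_N.
- by apply: (regular_fun_poly (p := 'X_3)) => y _; rewrite row5E mevalXU.
- by apply: (regular_fun_poly (p := 'X_4)) => y _; rewrite row5E mevalXU.
Qed.

(** * Surjectivity, density and birationality *)

Lemma torus_N_neq0 : torus_N !=set0.
Proof.
(* Here N = 2, which is nonzero in characteristic zero. *)
exists (row5 1 1 1 1 (-1)); split; last first.
  by rewrite /row5_N !row5E mulrN mulr1 opprK -[_ + _]/(2%:R)
    Num.Theory.pnatr_eq0.
by apply: forall_ord5; rewrite row5E ?oppr_eq0 oner_eq0.
Qed.

(** Since the image is all of [Phi_bar], its density is immediate. *)
Lemma proj_surjective v : Phi_bar v -> exists2 x, torus x & proj x = v.
Proof.
case=> [[sv [b2v [? ? ? [? ? Nv]]]]|[sv [[? ? ? ?] [b1v b2v Nv]]]].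
  exists (row5 (a1 v) (a2 v) (b1 v / sv_N v) (c1 v) (c2 v)).
    by apply: forall_ord5; rewrite row5E // mulf_neq0 // invr_neq0.
  rewrite /proj /row5_N !row5E [RHS](six_vertex_b2_eq0 sv b2v).
  by congr five_vertex; rewrite /sv_N b2v mulr0 addr0 in Nv *; rewrite divfK.
(* On [Phi_b] both b1 and N are zero, so any nonzero m solves b1 = m N. *)
exists (row5 (a1 v) (a2 v) 1 (c1 v) (c2 v)).
  by apply: forall_ord5; rewrite row5E // oner_eq0.
rewrite /proj /row5_N !row5E [RHS](six_vertex_b2_eq0 sv b2v) b1v.
by congr five_vertex; rewrite -Nv /sv_N b2v mulr0 addr0 mul1r.
Qed.

Lemma dominant_birational_proj :
  dominant_birational_morphism (@torus F 5) proj.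
Proof.
split.
- by move=> _ [x tx <-]; exact: proj_Phi_bar.
- exact: regular_proj.
- split=> [_ [x tx <-]|Z _ ZX _ [v /proj_surjective[x tx <-] <-]].
    by exists (proj x) => //; exact: proj_Phi_bar.
  by apply: ZX; exists x.
(* The isomorphism reaches the whole of [Phi], with inverse given by m = b1 / N. *)
exists torus_N, torus_N; rewrite image_Phi; split.
- exists [set x | mpoly_N.@[x 0] != 0]; first exact: zariski_open_neq0.
  by apply/seteqP; split=> x /=; rewrite meval_N.
- exact: torus_N_neq0.
- by exists setT; [exact: zariski_openT|rewrite setIT].
- exact: torus_N_neq0.
split; [exact: regular_proj|by move=> _ [x /torus_N_proj ? <-]|].
exists lift_Phi; split.
- exact: regular_lift.
- by move=> _ [y /torus_N_lift ? <-].
- exact: lift_PhiK.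
- exact: proj_liftK.
Qed.

(** * The variety structure of the torus and the bracket on composable pairs *)

Lemma quasi_affine_torus n : quasi_affine (@torus F n).
Proof.
exists setT; first exact: zariski_closedT.
exists (@torus F n); last by rewrite setTI.
by rewrite torusE; exact: zariski_open_neq0.
Qed.

Lemma irreducible_torus n : irreducible (@torus F n).
Proof.
rewrite torusE; apply: irreducible_neq0; rewrite -torusE.
by exists (const_mx 1) => i; rewrite mxE oner_eq0.
Qed.

Lemma yb_bracket_proj (u v w : @torus F 5) :
  tcomp u v = Some w ->
  yb_bracket (proj (val u)) (proj (val w)) (proj (val v)) = 0.
Proof.
move=> /tcompP[/eqP uv ->].
have tu := torus_val u; have tv := torus_val v.
(* [k] is m of the composite; composability gives m(v) = a1(u) k and m(u) = a2(v) k, the form that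
   [yb_bracket_five_vertex] expects. *)
pose k := val v 0 2 / val u 0 0.
have vE : val v 0 2 = val u 0 0 * k by rewrite mulrC divfK.
have uE : val u 0 2 = val v 0 1 * k.
  by apply: (mulfI (tu 0)); rewrite uv vE mulrCA.
rewrite /proj /row5_N !row5E -/k vE uE.
exact: yb_bracket_five_vertex.
Qed.

End Projection.

Theorem theorem7p1 (R : realType) :
  exists (n : nat) (G : set 'rV[complex R]_n) (gpd : groupoid G)
    (pi : 'rV[complex R]_n -> 'M[complex R]_(2 * 2)),
    [/\ quasi_affine G, irreducible G, dominant_birational_morphism G pi &
        forall u v w : G, gcomp gpd u v = Some w ->
          yb_bracket (pi (val u)) (pi (val w)) (pi (val v)) = 0%R].
Proof.
exists 5, (@torus (complex R) 5), (torus_groupoid (complex R)).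
exists (@proj (complex R)); split.
- exact: quasi_affine_torus.
- exact: irreducible_torus.
- exact: dominant_birational_proj.
- exact: yb_bracket_proj.
Qed.
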